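(* Let $n,m$ be integers with $1\le n\le m$. Then $\mathrm{Z}_{(1)}(P_n\square P_m)\le \min\{2n,m\}$.
   Context: $P_k$ is the path on $k$ vertices and $P_n\square P_m$ is the Cartesian product (rectangular grid graph): its vertices are $(x,y)$ with $1\le x\le n$, $1\le y\le m$, and $(x,y),(a,b)$ are adjacent if and only if ($x=a$ and $|y-b|=1$) or ($y=b$ and $|x-a|=1$). Zero forcing color change rule: a blue vertex $u$ may force (color blue) a white vertex $v$ if $v$ is the only white neighbor of $u$. A leak is a vertex that is not allowed to perform a force. A set $B\subseteq V(G)$ is a $1$-leaky forcing set of a graph $G$ if for every choice of a single vertex as a leak, starting with exactly $B$ blue (all others white) and iteratively applying the color change rule, with the leak not allowed to force, eventually colors all of $V(G)$ blue. $\mathrm{Z}_{(1)}(G)$ is the minimum size of a $1$-leaky forcing set of $G$. *)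

(* Defs.v *)
From mathcomp Require Import all_boot.
Set Implicit Arguments.
Unset Strict Implicit.
Unset Printing Implicit Defensive.

(* A graph with vertex set T is given by its adjacency relation e : rel T. *)

Definition path_adj (n : nat) : rel 'I_n :=
  fun i j => (i.+1 == j :> nat) || (j.+1 == i :> nat).

Definition cartesian_product (S T : finType) (e : rel S) (f : rel T) :
    rel (S * T) :=
  fun p q => ((p.1 == q.1) && f p.2 q.2) || ((p.2 == q.2) && e p.1 q.1).

(* The vertex (x, y) of the usual 1-based grid is (x - 1, y - 1) here. *)
Definition grid (n m : nat) : rel ('I_n * 'I_m) :=
  cartesian_product (@path_adj n) (@path_adj m).

Fact grid_sym n m : symmetric (@grid n m).
Proof.
move=> p q; rewrite /grid /cartesian_product /path_adj.
by rewrite (eq_sym p.1) (eq_sym p.2) orbC [in RHS]orbC; congr (_ && _ || _ && _);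
  rewrite orbC.
Qed.

Fact grid_irr n m : irreflexive (@grid n m).
Proof.
move=> p; rewrite /grid /cartesian_product /path_adj.
by rewrite !(gtn_eqF (ltnSn _)) !andbF.
Qed.

Section LeakyForcing.
Variables (T : finType) (e : rel T).

Definition white_neighbors (B : {set T}) (u : T) : {set T} :=
  [set w | e u w] :\: B.

(* u may force v when the set of blue vertices is B and l is the leak. *)
Definition may_force (l : T) (B : {set T}) (u v : T) : bool :=
  [&& u != l, u \in B & white_neighbors B u == [set v]].

Definition force_step (l : T) : rel {set T} :=
  fun B C => [exists u, exists v, may_force l B u v && (C == v |: B)].

Definition one_leaky_forcing (B : {set T}) : bool :=
  [forall l : T, connect (force_step l) B [set: T]].

Fact one_leaky_forcing_setT : one_leaky_forcing [set: T].
Proof. by apply/forallP=> l; apply: connect0. Qed.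

(* The default [set: T] satisfies the condition, by one_leaky_forcing_setT, so
   this is a genuine minimum. *)
Definition one_leaky_number : nat :=
  #|[arg min_(B < [set: T] | one_leaky_forcing B) #|B| ]|.

Fact one_leaky_numberP :
  (exists2 B, one_leaky_forcing B & #|B| = one_leaky_number) /\
  (forall B, one_leaky_forcing B -> one_leaky_number <= #|B|).
Proof.
rewrite /one_leaky_number; case: arg_minnP => [|B fB minB].
  exact: one_leaky_forcing_setT.
by split; [exists B | exact: minB].
Qed.

End LeakyForcing.

(* Main.v *)
Require Import Defs.
From mathcomp Require Import all_boot.
From mathcomp Require Import zify.
Set Implicit Arguments.
Unset Strict Implicit.
Unset Printing Implicit Defensive.

(** Suppose the forcing process gets stuck with leak (x, y), and let W be the
nonempty set of white vertices: no blue vertex except the leak has exactly one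
white neighbor.  Consider the vertices of W on an extreme diagonal, say those
maximizing j - i.  A vertex just outside this diagonal sees at most two
vertices of W, consecutive ones on it, so the white part of the diagonal can
only end at the leak or at a wall: its upper end is at the wall i = 0 or next to
the leak, its lower end at the wall j = m - 1 or next to the leak.  The same
holds for the other extreme diagonals, up to symmetry.

For the bound 2n, take the first and the last column: an extreme white column on
either side has to be adjacent to the leak, which cannot happen on both sides.
For the bound m, put d = uphalf n and take the staircase along the main diagonal from
(0, 0) to (d - 1, d - 1), continued along the row d - 1 up to the column m - d.
It meets each antidiagonal i + j = k with k < m once, so it has m vertices.
Either the triangle above it or the triangle below it does not contain the leak
and becomes blue; the extreme diagonals of W must then start at the leak, and
following them to the walls leads to a contradiction. *)

(** * Stuck colorings and extreme white vertices *)

Lemma one_leaky_forcing_closed (T : finType) (e : rel T) (B : {set T}) :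
  (forall (l : T) (C : {set T}), B \subset C ->
     (forall u v, ~~ may_force e l C u v) -> C = [set: T]) ->
  one_leaky_forcing e B.
Proof.
move=> closedT; apply/forallP => l.
pose reach C := connect (force_step e l) B C && (B \subset C).
have reachB : reach B by rewrite /reach connect0 subxx.
(* A largest reachable set admits no force, since a force would give a larger one. *)
have [C /andP[BC sBC] maxC] := arg_maxnP (fun C : {set T} => #|C|) reachB.
suff <- : C = [set: T] by [].
apply: (closedT l) => // u v; apply/negP => fuv.
have vC : v \notin C.
  have /and3P[_ _ /eqP wE] := fuv.
  by have := set11 v; rewrite -wE inE => /andP[].
have /maxC : reach (v |: C).
  rewrite /reach (subset_trans sBC (subsetUr _ _)) andbT.
  apply: connect_trans BC (connect1 _).
  by apply/existsP; exists u; apply/existsP; exists v; rewrite fuv eqxx.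
by rewrite /= cardsU1 vC add1n ltnn.
Qed.

(** Supplies extreme white vertices: [f] selects a diagonal or column, [g] an end of it. *)
Lemma lexmin (n m : nat) (w : nat -> nat -> bool) (f g : nat -> nat -> nat)
    (i0 j0 : nat) :
  (forall i j, w i j -> i < n /\ j < m) -> w i0 j0 ->
  exists i j, w i j /\ forall i' j', w i' j' ->
    f i j < f i' j' \/ f i j = f i' j' /\ g i j <= g i' j'.
Proof.
move=> wb w0; have [i0n j0m] := wb _ _ w0.
pose P := [pred p : 'I_n * 'I_m | w p.1 p.2].
have P0 : P (Ordinal i0n, Ordinal j0m) by [].
have [p Pp minp] := arg_minnP (fun p : 'I_n * 'I_m => f p.1 p.2) P0.
pose Q := [pred q | P q & f q.1 q.2 == f p.1 p.2].
have Qp : Q p by rewrite /Q /= eqxx andbT.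
have [q /andP[Pq /eqP fq] minq] := arg_minnP (fun q : 'I_n * 'I_m => g q.1 q.2) Qp.
exists q.1, q.2; split=> // i j wij; have [i_n j_m] := wb _ _ wij.
have := minp (Ordinal i_n, Ordinal j_m) wij.
rewrite /= -fq leq_eqVlt => /predU1P[fE|]; last by left.
by right; split=> //; apply: (minq (Ordinal i_n, Ordinal j_m)); rewrite /= wij -fE fq eqxx.
Qed.

(** Unbounded [nat] coordinates let [lia] settle adjacency; white vertices get their bounds from
    [stalled]. *)
Definition nadj (i j i' j' : nat) : Prop :=
  (i = i' /\ (j.+1 = j' \/ j'.+1 = j)) \/ (j = j' /\ (i.+1 = i' \/ i'.+1 = i)).

(* [w] is the set of white vertices when the process with leak (x, y) is stuck. *)
Definition stalled (n m x y : nat) (w : nat -> nat -> bool) : Prop :=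
  (forall i j, w i j -> i < n /\ j < m) /\
  (forall i j i' j', i < n -> j < m -> ~~ w i j -> ~ (i = x /\ j = y) ->
     nadj i j i' j' -> w i' j' ->
     exists i'' j'', [/\ nadj i j i'' j'', w i'' j'' & ~ (i'' = i' /\ j'' = j')]).

Lemma grid_one_leaky_forcing (n m : nat) (B : {set 'I_n * 'I_m}) :
  (forall x y w, stalled n m x y w ->
     (forall p : 'I_n * 'I_m, p \in B -> ~~ w p.1 p.2) ->
     forall i j, ~~ w i j) ->
  one_leaky_forcing (@grid n m) B.
Proof.
move=> stalledB; apply: one_leaky_forcing_closed => l C sBC stuck.
pose w (i j : nat) :=
  [exists p : 'I_n * 'I_m, [&& p.1 == i :> nat, p.2 == j :> nat & p \notin C]].
have wE (p : 'I_n * 'I_m) : w p.1 p.2 = (p \notin C).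
  apply/existsP/idP => [[q /and3P[/eqP q1 /eqP q2]]|pC]; last first.
    by exists p; rewrite !eqxx.
  suff -> : q = p by [].
  by case: p q q1 q2 => [a b] [c d] /= /val_inj-> /val_inj->.
have gridP (p q : 'I_n * 'I_m) : reflect (nadj p.1 p.2 q.1 q.2) (grid p q).
  apply: (iffP idP); rewrite /grid /cartesian_product /path_adj /nadj -!val_eqE /=; lia.
apply/eqP; rewrite -subTset; apply/subsetP => p _; rewrite -[_ \in _]negbK -wE.
apply: (stalledB l.1 l.2 w) => [|q /(subsetP sBC) qC]; last by rewrite wE qC.
split=> [i j /existsP[q /and3P[/eqP<- /eqP<- _]] //|].
move=> i j i' j' i_n j_m.
pose u : 'I_n * 'I_m := (Ordinal i_n, Ordinal j_m).
rewrite -[w i j]/(w u.1 u.2) wE negbK => uC uNl adj /existsP[v].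
move=> /and3P[/eqP v1 /eqP v2 vC]; subst i' j'.
have guv : grid u v by apply/gridP.
have /negP := stuck u v; rewrite /may_force uC.
have -> /= : u != l by apply/eqP => ul; apply: uNl; rewrite -ul.
move=> wNv; have /subsetPn[q] : ~~ (white_neighbors (@grid n m) C u \subset [set v]).
  apply/negP => sub; apply: wNv; rewrite eqEsubset sub sub1set !inE.
  by rewrite vC guv.
rewrite !inE => /andP[qC /gridP guq] qv; exists q.1, q.2; split=> //.
  by rewrite wE.
move=> [q1 q2]; move/eqP: qv; apply.
by case: q v q1 q2 {guq qC vC adj guv wNv} => [a b] [c e] /= /val_inj-> /val_inj->.
Qed.

(** * The staircase set *)

Definition staircase (m d i j : nat) : bool :=
  ((i.+1 < d) && ((j == i) || (j == i.+1))) ||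
  [&& i.+1 == d, i <= j & j + d <= m].

Section Staircase.
Variables (n m x y : nat) (w : nat -> nat -> bool).
Hypotheses (hn : 0 < n) (hnm : n <= m) (wS : stalled n m x y w).
Let d := uphalf n.
Hypothesis wB : forall i j, staircase m d i j -> ~~ w i j.

Let wb i j : w i j -> i < n /\ j < m. Proof. by case: wS => + _; apply. Qed.

Let wR i j i' j' : i < n -> j < m -> (w i j -> False) -> ~ (i = x /\ j = y) ->
  nadj i j i' j' -> w i' j' ->
  exists i'' j'', [/\ nadj i j i'' j'', w i'' j'' & ~ (i'' = i' /\ j'' = j')].
Proof. by case: wS => _ wS2 ? ? /negP; apply: wS2. Qed.

Let wNB i j : w i j -> ~ staircase m d i j.
Proof. by move=> wij /wB; rewrite wij. Qed.

(** The excluded leaks are the left neighbors of the non-staircase vertices of this region. For a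
    white vertex with i + j minimal, then i maximal, the left neighbor sees no other white
    vertex. *)
Lemma blue_above_staircase :
  ~ (x.+1 < d /\ x < y /\ x + y + 2 <= m) ->
  forall i j, i < d -> i <= j -> i + j < m -> ~~ w i j.
Proof.
move=> leak i0 j0 i0d ij0 ij0m; apply/negP => w0.
pose w' i j := [&& w i j, i < d, i <= j & i + j < m].
have w'0 : w' i0 j0 by rewrite /w' w0; lia.
have w'b i j : w' i j -> i < n /\ j < m by move=> /and4P[/wb].
have [i [j [/and4P[wij id ij ijm] min]]] :=
  lexmin (fun i j => i + j) (fun i j => n - i) w'b w'0.
have := wNB wij; rewrite /staircase => NB.
have [i_n j_m] := wb wij.
have [a [b [adj wab ab]]] : exists i'' j'',
    [/\ nadj i j.-1 i'' j'', w i'' j'' & ~ (i'' = i /\ j'' = j)].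
  apply: wR wij; rewrite /nadj; try lia.
  by move=> wu; have := min i j.-1; rewrite /w' wu /=; lia.
have := min a b; rewrite /w' wab /= /nadj in adj *; lia.
Qed.

(** A leak with x < y is never the upper neighbor of a vertex below the main diagonal, so the
    mirrored argument applies. *)
Lemma blue_below_staircase : x < y ->
  forall i j, j <= i -> i + j < n -> ~~ w i j.
Proof.
move=> leak i0 j0 ij0 ij0n; apply/negP => w0.
pose w' i j := [&& w i j, j <= i & i + j < n].
have w'0 : w' i0 j0 by rewrite /w' w0; lia.
have w'b i j : w' i j -> i < n /\ j < m by move=> /and3P[/wb].
have [i [j [/and3P[wij ij ijn] min]]] :=
  lexmin (fun i j => i + j) (fun i j => n - j) w'b w'0.
have {}ij : j < i by have := wNB wij; rewrite /staircase; lia.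
have [i_n j_m] := wb wij.
have [a [b [adj wab ab]]] : exists i'' j'',
    [/\ nadj i.-1 j i'' j'', w i'' j'' & ~ (i'' = i /\ j'' = j)].
  apply: wR wij; rewrite /nadj; try lia.
  by move=> wu; have := min i.-1 j; rewrite /w' wu /=; lia.
have {min} := min a b; have := wNB wab; rewrite /w' wab /= => NB min.
have [bi|bi] := leqP b a.
  by rewrite bi in min; case: adj => [] [? [] ?]; lia.
(* Here b = a + 1, and this vertex is on the staircase. *)
by apply: NB; rewrite /staircase; case: adj => [] [? [] ?]; lia.
Qed.

(* The extreme diagonals j - i = max and i + j = min. *)
Lemma leak_above_staircase i0 j0 : w i0 j0 -> x.+1 < d /\ x < y /\ x + y + 2 <= m.
Proof.
move=> w0.
suff: ~ ~ (x.+1 < d /\ x < y /\ x + y + 2 <= m) by lia.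
move=> leak; have blue := blue_above_staircase leak.
(* The diagonal j - i = max starts just below the leak and descends to the last column. *)
have NE : x.+1 + m.-1 < n + y.
  have [i [j [wij min]]] :=
    lexmin (fun i j => i + m - j) (fun i j => i) wb w0.
  have [i_n j_m] := wb wij.
  have i_gt0 : 0 < i.
    by case: i wij {min i_n} => // w0j; have := blue 0 j; rewrite w0j; lia.
  have [ix jy] : i.-1 = x /\ j = y.
    suff: ~ ~ (i.-1 = x /\ j = y) by lia.
    move=> Nl; have [a [b [adj wab ab]]] : exists i'' j'',
      [/\ nadj i.-1 j i'' j'', w i'' j'' & ~ (i'' = i /\ j'' = j)].
      apply: wR wij; rewrite /nadj; try lia.
      by move/min; lia.
    by have [_ bm] := wb wab; have := min a b wab; rewrite /nadj in adj; lia.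
  have wk k : y + k < m -> w (x.+1 + k) (y + k).
    elim: k => [_|k IH ykm]; first by rewrite !addn0 -jy -ix prednK.
    have wk := IH ltac:(lia); have [kn _] := wb wk.
    have [a [b [adj wab ab]]] : exists i'' j'',
      [/\ nadj (x.+1 + k) (y + k.+1) i'' j'', w i'' j'' &
          ~ (i'' = x.+1 + k /\ j'' = y + k)].
      apply: wR wk; rewrite /nadj; try lia.
      by move/min; lia.
    have [_ bm] := wb wab; have min' := min a b wab; rewrite /nadj in adj.
    by have [<- <-] : a = x.+1 + k.+1 /\ b = y + k.+1 by lia.
  by have /wb := wk (m.-1 - y) ltac:(lia); lia.
(* Likewise i + j = min descends from the leak to the first column. *)
have NW : x.+1 + y < n.
  have [i [j [wij min]]] := lexmin (fun i j => i + j) (fun i j => i) wb w0.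
  have [i_n j_m] := wb wij.
  have i_gt0 : 0 < i.
    by case: i wij {min i_n} => // w0j; have := blue 0 j; rewrite w0j; lia.
  have [ix jy] : i.-1 = x /\ j = y.
    suff: ~ ~ (i.-1 = x /\ j = y) by lia.
    move=> Nl; have [a [b [adj wab ab]]] : exists i'' j'',
      [/\ nadj i.-1 j i'' j'', w i'' j'' & ~ (i'' = i /\ j'' = j)].
      apply: wR wij; rewrite /nadj; try lia.
      by move/min; lia.
    by have := min a b wab; rewrite /nadj in adj; lia.
  have wk k : k <= y -> w (x.+1 + k) (y - k).
    elim: k => [_|k IH yk]; first by rewrite addn0 subn0 -jy -ix prednK.
    have wk := IH ltac:(lia); have [kn km] := wb wk.
    have [a [b [adj wab ab]]] : exists i'' j'',
      [/\ nadj (x.+1 + k) (y - k.+1) i'' j'', w i'' j'' &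
          ~ (i'' = x.+1 + k /\ j'' = y - k)].
      apply: wR wk; rewrite /nadj; try lia.
      by move/min; lia.
    have min' := min a b wab; rewrite /nadj in adj.
    by have [<- <-] : a = x.+1 + k.+1 /\ b = y - k.+1 by lia.
  by have /wb := wk y (leqnn y); lia.
(* As n <= m, [NE] and [NW] put the leak in the triangle excluded by [leak]. *)
lia.
Qed.

(* The extreme diagonal j - i = min. *)
Lemma staircase_no_white i0 j0 : ~~ w i0 j0.
Proof.
apply/negP => w0; have [xd [xy xym]] := leak_above_staircase w0.
have blue := blue_below_staircase xy.
have [i [j [wij min]]] :=
  lexmin (fun i j => j + n - i) (fun i j => i) wb w0.
have [i_n j_m] := wb wij.
have j_gt0 : 0 < j.
  by case: j wij {min j_m} => // wi0; have := blue i 0; rewrite wi0; lia.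
have [ix jy] : i = x /\ j.-1 = y.
  suff: ~ ~ (i = x /\ j.-1 = y) by lia.
  move=> Nl; have [a [b [adj wab ab]]] : exists i'' j'',
    [/\ nadj i j.-1 i'' j'', w i'' j'' & ~ (i'' = i /\ j'' = j)].
    apply: wR wij; rewrite /nadj; try lia.
    by move/min; lia.
  by have [an _] := wb wab; have := min a b wab; rewrite /nadj in adj; lia.
have wk k : x + k < n -> w (x + k) (y.+1 + k).
  elim: k => [_|k IH xkn]; first by rewrite !addn0 -jy -ix prednK.
  have wk := IH ltac:(lia); have [_ km] := wb wk.
  have [a [b [adj wab ab]]] : exists i'' j'',
    [/\ nadj (x + k.+1) (y.+1 + k) i'' j'', w i'' j'' &
        ~ (i'' = x + k /\ j'' = y.+1 + k)].
    apply: wR wk; rewrite /nadj; try lia.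
    by move/min; lia.
  have [an _] := wb wab; have min' := min a b wab; rewrite /nadj in adj.
  by have [<- <-] : a = x + k.+1 /\ b = y.+1 + k.+1 by lia.
(* Reaching row n - 1 gives y + n - x < m; since 2d <= n + 1, the diagonal then crosses row d - 1 on
   the staircase. *)
have /wb[_ endm] := wk (n.-1 - x) ltac:(lia).
have := wNB (wk (d.-1 - x) ltac:(lia)); rewrite /staircase; lia.
Qed.

End Staircase.

(** * The two bounds *)

Lemma one_leaky_number_grid_le_width (n m : nat) : 0 < n -> n <= m ->
  one_leaky_number (@grid n m) <= m.
Proof.
move=> hn hnm; have [_ minB] := one_leaky_numberP (@grid n m).
pose B := [set p : 'I_n * 'I_m | staircase m (uphalf n) p.1 p.2].
have fB : one_leaky_forcing (@grid n m) B.
  apply: grid_one_leaky_forcing => x y w wS wB; have wb := wS.1.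
  apply: staircase_no_white wS _ => // i j ijB; apply/negP => wij.
  have [i_n j_m] := wb _ _ wij.
  by have := wB (Ordinal i_n, Ordinal j_m); rewrite inE /= ijB wij => /(_ isT).
apply: leq_trans (minB B fB) _.
(* The default [p.2] is never taken on [B], where i + j < m. *)
pose f (p : 'I_n * 'I_m) : 'I_m := insubd p.2 (p.1 + p.2).
have injf : {in B &, injective f}.
  move=> [i j] [i' j']; rewrite !inE /staircase /= => pB qB /(congr1 val).
  rewrite !val_insubd /=; case: ifP; last by lia.
  case: ifP; last by lia.
  move=> _ _ ijE; congr (_, _); apply: val_inj => /=; lia.
by rewrite -(card_in_imset injf) (leq_trans (max_card _)) ?card_ord.
Qed.

Lemma one_leaky_number_grid_le_twice_height (n m : nat) : 0 < m ->
  one_leaky_number (@grid n m) <= 2 * n.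
Proof.
move=> hm; have [_ minB] := one_leaky_numberP (@grid n m).
have lastm : m.-1 < m by rewrite prednK.
pose J := [set Ordinal hm; Ordinal lastm].
pose B : {set 'I_n * 'I_m} := setX setT J.
have fB : one_leaky_forcing (@grid n m) B.
  apply: grid_one_leaky_forcing => x y w [wb wR] wB i0 j0; apply/negP => w0.
  have wNB i j : w i j -> 0 < j < m.-1.
    move=> wij; have [i_n j_m] := wb _ _ wij.
    have := wB (Ordinal i_n, Ordinal j_m); rewrite !inE -!val_eqE /= wij; lia.
  (* A vertex just left of the first white column sees at most one white vertex, so the one next to
     a white vertex is the leak. *)
  have left : forall i j, w i j -> y < j.
    have [i [j [wij min]]] := lexmin (fun i j => j) (fun i j => 0) wb w0.
    have [i_n j_m] := wb _ _ wij; have := wNB _ _ wij => jb.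
    suff ->: y = j.-1 by move=> a b /min; lia.
    apply/eqP/negP => Nl; have [a [b [adj wab ab]]] : exists i'' j'',
      [/\ nadj i j.-1 i'' j'', w i'' j'' & ~ (i'' = i /\ j'' = j)].
      apply: wR wij; rewrite /nadj; try lia.
      by apply/negP => /min; lia.
    by have := min a b wab; rewrite /nadj in adj; lia.
  have [i [j [wij min]]] := lexmin (fun i j => m - j) (fun i j => 0) wb w0.
  have [i_n j_m] := wb _ _ wij; have := wNB _ _ wij => jb.
  have yj := left _ _ wij.
  (* By [left], the leak is not at (i, j + 1). *)
  have [a [b [adj wab ab]]] : exists i'' j'',
    [/\ nadj i j.+1 i'' j'', w i'' j'' & ~ (i'' = i /\ j'' = j)].
    apply: wR wij; rewrite /nadj; try lia.
    by apply/negP => /min; lia.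
  by have [_ bm] := wb _ _ wab; have := min a b wab; rewrite /nadj in adj; lia.
apply: leq_trans (minB B fB) _.
(* For m = 1 the two columns coincide. *)
by rewrite cardsX cardsT card_ord mulnC leq_mul2r cards2 orbC; case: eqP.
Qed.

Theorem theorem4p10 (n m : nat) (hn : 1 <= n) (hnm : n <= m) :
  one_leaky_number (@grid n m) <= minn (2 * n) m.
Proof.
rewrite leq_min one_leaky_number_grid_le_width // andbT.
exact: one_leaky_number_grid_le_twice_height (leq_trans hn hnm).
Qed.
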